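(* Let $d\ge 2$, $b>0$, $a\ge 1$ and $\nu_d<0$, let $\mu_a^{(d)}$ be the full-dimensional facet submodel (with intensity function of facet centres $\chi\equiv 1$), and let $\pi=P_{\mu_a^{(d)}}\theta^{-1}$ be the distribution on $\mathbb{N}_0^d$ of the vector $(\theta_1(\mu_a^{(d)}),\dots,\theta_d(\mu_a^{(d)}))$ of numbers of facets with each orientation. Then for $(k_1,\dots,k_d)\in\mathbb{N}_0^d$, $$\pi(k_1,\dots,k_d)\propto \frac{A^{\sum_{i=1}^d k_i}}{k_1!\cdots k_d!}\exp\left(\nu_d\prod_{i=1}^d k_i\right),\qquad A=\frac{ab^d}{d},$$ where $\propto$ means equality up to a multiplicative constant not depending on $(k_1,\dots,k_d)$.
   Context: Let $\mathbb{N}_0=\{0,1,2,\dots\}$ and $[d]=\{1,\dots,d\}$, and let $e_1,\dots,e_d$ be the standard orthonormal basis of $\mathbb{R}^d$. Facets: $Y=[0,b]^d\times\{2b\}\times\{e_1,\dots,e_d\}$. A point $((z_1,\dots,z_d),2b,e_l)\in Y$ is identified with the facet $\{(x_1,\dots,x_d)\in\mathbb{R}^d:\ x_l=z_l,\ |x_i-z_i|\le b\ \text{for } i\in[d]\setminus\{l\}\}$; $e_l$ is its orientation. Measure: $\lambda$ is the finite measure on $Y$ given by $\lambda(\mathrm{d}(z,r,\phi))=\chi(z)\,\mathrm{d}z\,\delta_{2b}(\mathrm{d}r)\,\frac1d\sum_{i=1}^d\delta_{e_i}(\mathrm{d}\phi)$, where $\delta$ denotes Dirac measure; here $\chi\equiv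 1$ on $[0,b]^d$. $\mathbf{N}$ is the space of integer-valued finite measures on $Y$ whose atoms all have mass one, identified with finite subsets $\mathbf{x}\subset Y$, with the smallest $\sigma$-algebra making all maps $\mathbf{x}\mapsto\mathbf{x}(B)$, $B\subset Y$ Borel, measurable. $\eta_a$ is the Poisson process on $Y$ with intensity measure $a\lambda$. For $\mathbf{x}\in\mathbf{N}$ put $G_d(\mathbf{x})=\frac{1}{d!}\sum_{(x_1,\dots,x_d)\in\mathbf{x}^d_{\neq}}\mathbb{H}^0\left(\bigcap_{i=1}^d x_i\right)$, where the sum is over ordered $d$-tuples of distinct points of $\mathbf{x}$ and $\mathbb{H}^0$ is counting measure (the Hausdorff measure of order $0$). The full-dimensional submodel $\mu_a^{(d)}$ is the point process on $Y$ with density $p(\mathbf{x})=c_a\exp(\nu_d G_d(\mathbf{x}))$ with respect to the distribution of $\eta_a$, where $\nu_d<0$ and $c_a$ is the normalizing constant. The map $\theta:\mathbf{N}\to\mathbb{N}_0^d$, $\theta(\mathbf{x})=(\theta_1(\mathbf{x}),\dots,\theta_d(\mathbf{x}))$, is defined by letting $\theta_i(\mathbf{x})$ be the number of facets in $\mathbf{x}$ with orientation $e_i$. $P_{\mu_a^{(d)}}$ denotes the distribution of $\mu_a^{(d)}$. *)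

(* Defs.v *)
From HB Require Import structures.
From mathcomp Require Import all_boot all_order all_algebra finmap.
From mathcomp Require Import all_classical all_reals all_analysis.

Set Implicit Arguments.
Unset Strict Implicit.
Unset Printing Implicit Defensive.

Import Order.TTheory GRing.Theory Num.Theory.
Local Open Scope classical_set_scope.
Local Open Scope ring_scope.

Section facets.
Context (R : realType) (d : nat) (b : R).

(* Points (z, r, phi) of R^d x R x R^d; R^d is d.-tuple R, which carries the
   product (Borel) sigma-algebra. *)
Definition mark_space : Type := (d.-tuple R * R * d.-tuple R)%type.

Definition basis_vec (l : 'I_d) : d.-tuple R := [tuple (i == l)%:R | i < d].

Definition cube : set (d.-tuple R) :=
  [set z | forall i, 0 <= tnth z i <= b].

Definition facets : set mark_space :=
  (cube `*` [set 2 * b]) `*` range basis_vec.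

Definition facet_set (p : mark_space) : set (d.-tuple R) :=
  [set x | exists l : 'I_d,
    [/\ p.2 = basis_vec l, tnth x l = tnth p.1.1 l &
        forall i, i != l -> `|tnth x i - tnth p.1.1 i| <= b]].

(* d-dimensional Lebesgue measure, as an iterated integral. *)
Fixpoint lebesgue_tuple (n : nat) : set (n.-tuple R) -> \bar R :=
  match n return set (n.-tuple R) -> \bar R with
  | 0 => \d_[tuple]
  | m.+1 => fun A => (\int[lebesgue_measure]_x
      @lebesgue_tuple m [set t : m.-tuple R | A (cons_tuple (x : R) t)])%E
  end.

(* lambda (d(z, r, phi)) =
     1_[0,b]^d (z) dz  delta_2b (dr)  1/d \sum_i delta_(e_i) (d phi),
   i.e. with chi = 1 on the cube. *)
Definition lambda (B : set mark_space) : \bar R :=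
  ((d%:R^-1)%:E * \sum_(l < d)
     lebesgue_tuple (cube `&` [set z | B (z, (2 * b)%R, basis_vec l)]))%E.

Definition borel_facets (B : set mark_space) : Prop :=
  measurable B /\ B `<=` facets.

(* An integer-valued finite measure on facets with unit atoms is its support, a
   finite set of facets. *)
Definition count_in (B : set mark_space) (x : {fset facets}) : nat :=
  #|` [fset p in x | val p \in B]%fset |.

Definition count_events : set (set {fset facets}) :=
  [set F | exists B n, borel_facets B /\ F = [set x | count_in B x = n]].

Definition config := g_sigma_algebraType count_events.

(* Distribution of the Poisson process with intensity measure a lambda. The
   second argument of poisson_prob is a dummy; poisson_prob 0 is the Dirac mass
   at 0 (whereas poisson_pmf 0 is not a probability mass function). *)
Definition poisson_law (a : R) (P : probability config R) : Prop :=
  (forall B, borel_facets B -> forall n : nat,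
     P [set x | count_in B x = n] =
     poisson_prob (fine (a%:E * lambda B)%E) 0 [set n]) /\
  (forall m (B : 'I_m -> set mark_space), (forall i, borel_facets (B i)) ->
     trivIset setT B -> forall n : 'I_m -> nat,
     P [set x | forall i, count_in (B i) x = n i] =
     (\prod_(i < m) P [set x | count_in (B i) x = n i])%E).

(* H^0 is the counting measure and may be infinite, so that G_d takes values in
   the extended reals. *)
Definition G_d (x : config) : \bar R :=
  ((d`!%:R^-1)%:E *
   \sum_(t : d.-tuple (x : {fset facets}) | uniq t)
     counting (\bigcap_(i in [set: 'I_d]) facet_set (val (val (tnth t i)))))%E.

(* expeR -oo = 0, so that exp (nu * +oo) = 0 for nu < 0. *)
Definition gibbs_weight (nu : R) (x : config) : \bar R :=
  expeR (nu%:E * G_d x)%E.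

Definition norm_cst (nu : R) (P : probability config R) : R :=
  (fine (\int[P]_x gibbs_weight nu x)%E)^-1.

Definition has_density (P Q : probability config R) (p : config -> \bar R) :
    Prop :=
  forall F, measurable F -> Q F = (\int[P]_(x in F) p x)%E.

Definition submodel_law (a nu : R) (Q : probability config R) : Prop :=
  exists2 P, poisson_law a P &
    has_density P Q (fun x => (norm_cst nu P)%:E * gibbs_weight nu x)%E.

Definition theta (x : config) : d.-tuple nat :=
  [tuple #|` [fset p in (x : {fset facets}) | (val p).2 == basis_vec i]%fset |
    | i < d].

End facets.

(* Main.v *)
Require Import Defs.
From HB Require Import structures.
From mathcomp Require Import all_boot all_order all_algebra finmap.
From mathcomp Require Import all_fingroup.
From mathcomp Require Import all_classical all_reals all_analysis.
From mathcomp Require Import ring lra.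

Import Order.TTheory GRing.Theory Num.Theory.
Local Open Scope classical_set_scope.
Local Open Scope ring_scope.

(** All centres lie in the cube of side [b], so their coordinates differ by at
    most [b], the half-width of a facet. Hence [d] facets with pairwise
    different orientations meet in exactly one point: its [l]-th coordinate is
    dictated by the facet orthogonal to [e_l], and this point satisfies the
    other constraints ([counting_facets]). Two facets with the same orientation are
    parallel, and disjoint unless their centres share the coordinate along that
    orientation. If no such coincidence occurs in [x] ([general_position]), then
    [d! * G_d x] counts the ordered [d]-tuples of facets that realise each
    orientation once, so that [G_d x] is the product of the numbers [theta x] of
    facets of each orientation ([G_d_general_position]).

    Coincidences are negligible for the Poisson process
    ([general_position_ae]): slicing the cube into [n] strips orthogonal to
    [e_l], each of intensity [A / n], a coincidence puts two points into one
    strip, which has probability at most [n * (A / n) ^ 2]. As the law of the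
    submodel has a density, it does not charge coincidences either, and on the
    event [theta = k] the density is almost surely the constant
    [c * exp (nu * \prod_i k_i)]. What remains is the Poisson probability of
    this event ([theta_law]): the facets of orientation [e_i] are those in the
    set [oriented_box] given by the whole cube, and these [d] disjoint sets have
    mass [A] each, so that the counts are independent Poisson variables of
    mean [A]. Altogether the proportionality constant is [c * exp (- A) ^ d]. *)

(** * Orientations and the intersection statistic *)

Definition orient {R : realType} {d : nat} {b : R} (p : facets (d:=d) b)
  (l : 'I_d) : bool := (\val p).2 == basis_vec R l.

Lemma basis_vec_inj {R : realType} {d : nat} : injective (@basis_vec R d).
Proof.
move=> l m /(congr1 (fun t => tnth t l)); rewrite !tnth_mktuple eqxx.
by case: eqP => [//|_] /eqP; rewrite oner_eq0.
Qed.

Lemma orient_inj {R : realType} {d : nat} {b : R} (p : facets (d:=d) b) l m :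
  orient p l -> orient p m -> l = m.
Proof. by move=> /eqP pl /eqP; rewrite pl => /basis_vec_inj. Qed.

Lemma orient_exists {R : realType} {d : nat} {b : R} (p : facets (d:=d) b) :
  exists l, orient p l.
Proof.
have := set_valP p => -[_ [l _ pl]]; exists l; exact/eqP.
Qed.

Lemma centre_cube {R : realType} {d : nat} {b : R} (p : facets (d:=d) b) i :
  0 <= tnth (\val p).1.1 i <= b.
Proof. by have [[]] := set_valP p. Qed.

(** For a fixed permutation [s], distributivity turns the number of tuples whose
    [i]-th entry is related to [s i], for all [i], into a product over [i],
    which [s] only permutes; hence the factor [d!]. *)
Lemma sum_perm_assignments (T : finType) (d : nat) (o : T -> 'I_d -> bool) :
  (\sum_(t : d.-tuple T) \sum_(s : 'S_d) [forall i, o (tnth t i) (s i)] =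
   d`! * \prod_(l < d) #|[pred p | o p l]|)%N.
Proof.
rewrite exchange_big /= (eq_bigr (fun=> \prod_(l < d) #|[pred p | o p l]|)%N).
  by rewrite sum_nat_const card_Sn.
move=> s _; rewrite (reindex_inj (@perm_inj _ s)) /=.
under [RHS]eq_bigr do rewrite -sum1_card big_mkcond /=.
rewrite bigA_distr_bigA /=.
rewrite (reindex (fun f : {ffun 'I_d -> T} => [tuple f i | i < d])) /=; last first.
  exists (fun t : d.-tuple T => [ffun i => tnth t i]) => [f|t] _.
    by apply/ffunP => i; rewrite ffunE tnth_mktuple.
  by apply: eq_from_tnth => i; rewrite tnth_mktuple ffunE.
apply: eq_bigr => f _; set B := [forall i, _]; case: (boolP B) => [/forallP ofl|].
  by rewrite big1 // => i _; have := ofl i; rewrite tnth_mktuple inE => ->.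
rewrite negb_forall => /existsP[i]; rewrite tnth_mktuple => /negbTE oi.
by rewrite (bigD1 i) //= inE oi.
Qed.

Lemma theta_card {R : realType} {d : nat} {b : R} (x : {fset facets (d:=d) b}) i :
  tnth (theta (x : config d b)) i = #|[pred p : x | orient (val p) i]|.
Proof.
rewrite tnth_mktuple card_fset_sum1 big_fset /= big_seq_fsetE /= sum1_card.
by apply: eq_card.
Qed.

(** Only parallel facets have to be kept apart: [d] facets of different
    orientations always meet in a single point. *)
Definition general_position {R : realType} {d : nat} {b : R}
    (x : {fset facets (d:=d) b}) :=
  forall p q l, p \in x -> q \in x -> orient p l -> orient q l ->
    tnth (\val p).1.1 l = tnth (\val q).1.1 l -> p = q.

Section intersections.
Context {R : realType} {d : nat} {b : R}.
Implicit Types (x : {fset facets (d:=d) b}) (p q : facets (d:=d) b).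

Lemma facet_set_orient p l (u : d.-tuple R) :
  orient p l -> facet_set b (\val p) u <->
  tnth u l = tnth (\val p).1.1 l /\
  forall i, i != l -> `|tnth u i - tnth (\val p).1.1 i| <= b.
Proof.
move=> pl; split=> [[m [pm um ui]]|[ul ui]]; last first.
  by exists l; split=> //; exact/eqP.
have -> : l = m by apply: (orient_inj _ _ _ pl); exact/eqP.
by split.
Qed.

Lemma counting_set1 {T : choiceType} (u : T) : counting [set u] = 1%E :> \bar R.
Proof. by rewrite /counting asboolT// fset_set1 cardfs1. Qed.

(** The sum over permutations is 1 if the facets of [t] realise each orientation
    exactly once, and 0 otherwise. *)
Lemma counting_facets x (t : d.-tuple x) : general_position x -> uniq t ->
  counting (\bigcap_(i in [set: 'I_d]) facet_set b (val (val (tnth t i)))) =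
  (\sum_(s : 'S_d) [forall i, orient (val (tnth t i)) (s i)])%:R%:E :> \bar R.
Proof.
move=> gp ut.
have [f oP] : {f : 'I_d -> 'I_d | forall i, orient (val (tnth t i)) (f i)}.
  exists (fun i => projT1 (cid (orient_exists (val (tnth t i))))) => i.
  by case: cid.
have oE i l : orient (val (tnth t i)) l = (f i == l).
  by apply/idP/eqP => [/(orient_inj _ _ _ (oP i))|<-].
case: (boolP (injectiveb f)) => [/injectiveP io|/injectivePn[i [j ij oij]]].
- pose s0 := perm io; have s0E i : s0 i = f i by rewrite permE.
  rewrite (bigD1 s0) //= big1 ?addn0 => [|s ss0]; last first.
    apply/eqP; rewrite eqb0; apply: contraNN ss0 => /forallP so.
    by apply/eqP/permP => i; rewrite s0E; have := so i; rewrite oE => /eqP.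
  rewrite (_ : [forall i, _] = true) ?mulr1n; last first.
    by apply/forallP => i; rewrite s0E oP.
  (* The facet with orientation [e_l] fixes the l-th coordinate of a common
     point; the remaining constraints hold as all centres lie in the cube. *)
  pose u := [tuple tnth (\val (val (tnth t ((s0^-1)%g l)))).1.1 l | l < d].
  rewrite (_ : \bigcap_(_ in _) _ = [set u]) ?counting_set1//.
  apply/seteqP; split => [v /= vI|_ -> i _] /=.
    apply: eq_from_tnth => l; rewrite tnth_mktuple.
    have /(facet_set_orient _ _ _ (oP _))[] := vI ((s0^-1)%g l) I.
    by rewrite -s0E permKV => ->.
  apply/(facet_set_orient _ _ _ (oP i)); rewrite !tnth_mktuple.
  rewrite -{1}s0E permK; split => // l _; rewrite tnth_mktuple.
  set y := tnth _ l; set z := tnth _ l.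
  have /andP[y0 yb] : 0 <= y <= b by exact: centre_cube.
  have /andP[z0 zb] : 0 <= z <= b by exact: centre_cube.
  by rewrite ler_norml; apply/andP; split; rewrite ?lerBlDr ?lerBrDr; nra.
- (* Two of the facets are parallel, hence disjoint by general position. *)
  rewrite big1 => [|s _]; last first.
    apply/eqP; rewrite eqb0; apply/negP => /forallP so.
    have := so i; have := so j; rewrite !oE oij => /eqP -> /eqP/perm_inj ij'.
    by rewrite ij' eqxx in ij.
  rewrite (_ : \bigcap_(_ in _) _ = set0).
    by rewrite /counting asboolT// fset_set0.
  apply/seteqP; split => // v /= vI.
  have /(facet_set_orient _ _ _ (oP i))[vi _] := vI i Logic.I.
  have /(facet_set_orient _ _ _ (oP j))[vj _] := vI j Logic.I.
  have tij : val (tnth t i) = val (tnth t j).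
    apply: (gp _ _ (f i)); rewrite ?fsvalP ?oP ?oij ?oP//.
    by rewrite -vj -oij.
  by move: ij => /eqP[]; apply: (tuple_uniqP _ ut); exact: val_inj.
Qed.

Lemma G_d_general_position (x : config d b) : general_position x ->
  G_d x = (\prod_(i < d) tnth (theta x) i)%N%:R%:E.
Proof.
move=> gp; rewrite /G_d.
under eq_bigr => t ut do rewrite counting_facets//.
rewrite sumEFin -EFinM -natr_sum; congr (_%:E).
have -> : (\sum_(t : d.-tuple (x : {fset facets b}) | uniq t)
    \sum_(s : 'S_d) [forall i, orient (val (tnth t i)) (s i)] =
    d`! * \prod_(l < d) tnth (theta x) l)%N.
  under [in RHS]eq_bigr do rewrite theta_card.
  (* A tuple with a repeated facet repeats an orientation, so that no
     permutation matches it. *)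
  rewrite -sum_perm_assignments [RHS](bigID (fun t : d.-tuple _ => uniq t)) /=.
  rewrite [X in (_ + X)%N]big1 ?addn0// => t /tuple_uniqP nut.
  rewrite big1 // => s _; apply/eqP; rewrite eqb0; apply/negP => /forallP so.
  apply: nut => i j tij; apply: (@perm_inj _ s).
  by apply: (orient_inj _ _ _ (so i)); rewrite tij.
by rewrite natrM mulKf// pnatr_eq0 -lt0n fact_gt0.
Qed.

End intersections.

(** * Volumes, integrals and Poisson probabilities *)

Section box.
Context {R : realType}.

Lemma lebesgue_tuple0 n : @lebesgue_tuple R n set0 = 0%E.
Proof.
elim: n => [|n IH] /=; first by rewrite measure0.
by rewrite integral0_eq // => x _; rewrite -[RHS]IH; congr lebesgue_tuple.
Qed.

(** The iterated integral integrates out the first coordinate: the integrand is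
    constant on the first side of the box and vanishes outside it. *)
Lemma lebesgue_tuple_box n (lo hi : 'I_n -> R) : (forall i, lo i <= hi i) ->
  lebesgue_tuple [set z : n.-tuple R | forall i, lo i <= tnth z i <= hi i] =
  (\prod_(i < n) (hi i - lo i))%:E.
Proof.
elim: n lo hi => [|n IH] lo hi lohi.
  by rewrite big_ord0 /= diracE mem_set//= => -[].
have IHr := IH (fun i => lo (lift ord0 i)) (fun i => hi (lift ord0 i))
  (fun i => lohi _).
rewrite big_ord_recl EFinM -{}IHr /=.
set B := [set z : n.-tuple R | _].
transitivity (\int[lebesgue_measure]_(x in `[lo ord0, hi ord0])
  cst (lebesgue_tuple B) x)%E.
  rewrite [RHS]integral_mkcond; apply: eq_integral => x _.
  rewrite patchE; case: ifPn => [|/negP]; rewrite inE /= in_itv/= => lxh.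
    congr lebesgue_tuple; apply/seteqP; split => z /= zP i.
      by have := zP (lift ord0 i); rewrite tnthS.
    have [j ->|->//] := unliftP ord0 i.
    by rewrite tnthS.
  rewrite -[RHS](lebesgue_tuple0 n); congr lebesgue_tuple.
  by apply/seteqP; split => z //= /(_ ord0).
rewrite integral_cst//= lebesgue_measure_itv/= lte_fin muleC.
case: ltP => // hl; have -> : hi ord0 = lo ord0 by apply/eqP; rewrite eq_le hl lohi.
by rewrite subrr.
Qed.

End box.

(** This serves for the Gibbs weight on the set of coincidences, where it has no
    simple form. The integral is a supremum over the simple functions below [f],
    hence at most the integral of the constant [+oo]. *)
Lemma ge0_integral_null_set {d} {T : measurableType d} {R : realType}
    (mu : {measure set T -> \bar R}) (N : set T) (f : T -> \bar R) :
  measurable N -> mu N = 0%E -> (forall x, 0 <= f x)%E ->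
  (\int[mu]_(x in N) f x = 0)%E.
Proof.
move=> mN N0 f0; apply/eqP; rewrite eq_le integral_ge0 ?andbT//.
have <- : (\int[mu]_(x in N) cst +oo x = 0)%E by rewrite integral_cst// N0 mule0.
rewrite !ge0_integralE //=; apply: ereal_sup_le => _ [h /= hf <-].
exists h => // x; apply: (le_trans (hf x)).
by apply: lee_restrict => y _; exact: leey.
Qed.

(** The left-hand side is the probability that a Poisson variable of mean [m] is
    at least 2. With [1 - m <= exp (- m)] it is at most
    [1 - (1 + m) * (1 - m)]. *)
Lemma poisson_two_points_le {R : realType} (m : R) : 0 <= m ->
  1 - expR (- m) - m * expR (- m) <= m ^+ 2.
Proof. by move=> m0; have := expR_ge1Dx (- m); nra. Qed.

Lemma poisson_prob_set1 {R : realType} (m : R) n : 0 < m ->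
  poisson_prob m 0 [set n] = (m ^+ n / n`!%:R * expR (- m))%:E.
Proof.
by move=> m0; rewrite /poisson_prob m0 esum_set1 ?lee_fin ?poisson_pmf_ge0// /poisson_pmf m0.
Qed.

(** * Facets with centre in a box and prescribed orientation *)

Definition oriented_box {R : realType} {d : nat} (b : R) (lo hi : 'I_d -> R)
    (l : 'I_d) : set (mark_space R d) :=
  ([set z | forall i, lo i <= tnth z i <= hi i] `*` [set 2 * b]) `*`
  [set basis_vec R l].

Section oriented_boxes.
Context {R : realType} {d : nat} {b : R}.
Implicit Types (lo hi : 'I_d -> R) (l : 'I_d).

Lemma measurable_box lo hi :
  measurable [set z : d.-tuple R | forall i, lo i <= tnth z i <= hi i].
Proof.
rewrite (_ : [set _ | _] = \bigcap_(i in [set: 'I_d])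
    ((fun z : d.-tuple R => tnth z i) @^-1` `[lo i, hi i])).
  apply: fin_bigcap_measurable => // i _.
  rewrite -[X in measurable X]setTI; exact: measurable_tnth.
apply/seteqP; split=> z /= zP i; first by move=> _ /=; rewrite in_itv /= zP.
by have := zP i I; rewrite /= in_itv.
Qed.

Lemma measurable_tuple1 (v : d.-tuple R) : measurable [set v].
Proof.
rewrite (_ : [set v] = [set z | forall i, tnth v i <= tnth z i <= tnth v i]).
  exact: measurable_box.
apply/seteqP; split => [_ -> i /=|z /= zv]; first by rewrite lexx.
by apply: eq_from_tnth => i; apply/eqP; rewrite eq_le andbC.
Qed.

Lemma borel_oriented_box lo hi l :
  (forall i, 0 <= lo i) -> (forall i, hi i <= b) ->
  borel_facets b (oriented_box b lo hi l).
Proof.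
move=> lo0 hib; split.
  apply: measurableX; last exact: measurable_tuple1.
  apply: measurableX => //; exact: measurable_box.
move=> [[z r] v] [[/= zP ->] ->]; split => /=; last by exists l.
split => //= i; have /andP[lz zh] := zP i.
by rewrite (le_trans (lo0 i) lz) (le_trans zh (hib i)).
Qed.

Lemma lambda_oriented_box lo hi l :
  (forall i, 0 <= lo i) -> (forall i, lo i <= hi i) -> (forall i, hi i <= b) ->
  lambda b (oriented_box b lo hi l) = (d%:R^-1 * \prod_(i < d) (hi i - lo i))%:E.
Proof.
move=> lo0 lohi hib; rewrite /lambda EFinM; congr (_ * _)%E.
rewrite (bigD1 l) //= big1 ?adde0 => [|m ml].
  rewrite -lebesgue_tuple_box//; congr lebesgue_tuple.
  apply/seteqP; split => [z [_ [[]]]//|z /= zP]; split=> // i.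
  have /andP[lz zh] := zP i.
  by rewrite (le_trans (lo0 i) lz) (le_trans zh (hib i)).
rewrite -[RHS](lebesgue_tuple0 d); congr lebesgue_tuple.
apply/seteqP; split => // z [_ [_ /= /basis_vec_inj ml']].
by rewrite ml' eqxx in ml.
Qed.

(** This is how the Poisson law, which speaks of counts in Borel sets, applies
    to [theta]. *)
Lemma count_in_orientation l (x : {fset facets (d:=d) b}) :
  count_in (oriented_box b (fun=> 0) (fun=> b) l) x = tnth (theta (x : config d b)) l.
Proof.
rewrite tnth_mktuple /count_in; congr #|` _|; apply/fsetP => p.
rewrite !inE; congr (_ && _); apply/idP/eqP => [/set_mem[]//|pl].
apply/mem_set; split => //; split; first by move=> i; exact: centre_cube.
by have [[]] := set_valP p.
Qed.

Lemma measurable_count_in (B : set (mark_space R d)) n : borel_facets b B ->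
  measurable [set x : config d b | count_in B x = n].
Proof. by move=> mB; apply: sub_sigma_algebra; exists B, n. Qed.

Lemma measurable_theta (k : d.-tuple nat) :
  measurable (@theta R d b @^-1` [set k]).
Proof.
rewrite (_ : _ @^-1` _ = \bigcap_(i in [set: 'I_d]) [set x : config d b |
    count_in (oriented_box b (fun=> 0) (fun=> b) i) x = tnth k i]).
  apply: fin_bigcap_measurable => // i _; apply: measurable_count_in.
  exact: borel_oriented_box.
apply/seteqP; split => [x <- i _ /=|x xP]; first exact: count_in_orientation.
by apply: eq_from_tnth => i; rewrite -(xP i I) count_in_orientation.
Qed.

End oriented_boxes.

(** * The Poisson process of facets *)

Lemma grid_cover {R : realType} (h z : R) n :
  0 <= z <= h * n.+1%:R -> exists2 j, (j < n.+1)%N & h * j%:R <= z <= h * j.+1%:R.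
Proof.
elim: n => [|n IH] /andP[z0 zn]; first by exists 0%N; rewrite // mulr0 z0.
have [zn'|zn'] := leP z (h * n.+1%:R); last by exists n.+1; rewrite // ltW.
by have [|j jn jz] := IH; [rewrite z0|exists j; rewrite // ltnW].
Qed.

Section poisson_facets.
Context {R : realType} {d : nat} {a b : R} {P : probability (config d b) R}.
Hypotheses (a0 : 0 < a) (b0 : 0 < b) (Ppoi : poisson_law a P).

Lemma poisson_count_in (B : set (mark_space R d)) (v : R) n :
  borel_facets b B -> lambda b B = v%:E -> 0 < a * v ->
  P [set x | count_in B x = n] = ((a * v) ^+ n / n`!%:R * expR (- (a * v)))%:E.
Proof.
by move=> mB Bv av0; rewrite (Ppoi.1 B mB n) Bv /= poisson_prob_set1.
Qed.

Definition crowded (B : set (mark_space R d)) : set (config d b) :=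
  [set x | (1 < count_in B x)%N].

Lemma crowdedE (B : set (mark_space R d)) : crowded B =
  ~` ([set x | count_in B x = 0%N] `|` [set x | count_in B x = 1%N]).
Proof.
apply/seteqP; split=> x /=.
  by rewrite /crowded /= => c1 [] cE; rewrite cE in c1.
by rewrite /crowded /=; case: (count_in B x) => [|[|n]] // []; [left|right].
Qed.

Lemma measurable_crowded (B : set (mark_space R d)) :
  borel_facets b B -> measurable (crowded B).
Proof.
move=> mB; rewrite crowdedE.
by apply/measurableC/measurableU; exact: measurable_count_in.
Qed.

Lemma poisson_crowded (B : set (mark_space R d)) (v : R) :
  borel_facets b B -> lambda b B = v%:E -> 0 < a * v ->
  (P (crowded B) <= ((a * v) ^+ 2)%:E)%E.
Proof.
move=> mB Bv av0; have mc n := measurable_count_in B n mB.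
have pc n := poisson_count_in B v n mB Bv av0.
rewrite crowdedE probability_setC; last exact: measurableU.
rewrite measureU//; last by apply/seteqP; split=> // x [/= ->].
rewrite [X in (_ - X <= _)%E](_ : _ = (expR (- (a * v)) +
    a * v * expR (- (a * v)))%:E); last first.
  rewrite EFinD; congr (_ + _)%E; apply: (etrans (pc _)).
    by rewrite fact0 expr0 divr1 mul1r.
  by rewrite expr1 divr1.
by rewrite -EFinB lee_fin opprD addrA poisson_two_points_le// ltW.
Qed.

Definition coincident (l : 'I_d) : set (config d b) :=
  [set x | exists p q, [/\ p \in (x : {fset facets b}), q \in (x : {fset facets b}),
    orient p l, orient q l &
    tnth (\val p).1.1 l = tnth (\val q).1.1 l /\ p != q]].

(** The strips are closed, so that neighbours share a face: for a union bound
    they have to cover the cube, but not to be disjoint. *)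
Definition strip (l : 'I_d) n j : set (mark_space R d) :=
  oriented_box b (fun i => if i == l then b / n.+1%:R * j%:R else 0)
     (fun i => if i == l then b / n.+1%:R * j.+1%:R else b) l.

Lemma borel_strip l n j : (j < n.+1)%N -> borel_facets b (strip l n j).
Proof.
move=> jn; apply: borel_oriented_box => i; case: eqP => // _.
  by rewrite mulr_ge0// divr_ge0// ltW.
by rewrite mulrAC ler_pdivrMr// ler_pM2l// ler_nat.
Qed.

Lemma lambda_strip l n j : (j < n.+1)%N ->
  lambda b (strip l n j) = (b ^+ d / d%:R / n.+1%:R)%:E.
Proof.
move=> jn; rewrite lambda_oriented_box.
- congr EFin; rewrite (bigD1 l) //= eqxx (eq_bigr (fun=> b)) => [|i /negbTE ->].
    rewrite prodr_const cardC1 card_ord -mulrBr -natrB// subSnn mulr1.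
    have -> : b ^+ d = b * b ^+ d.-1 by rewrite -exprS prednK// (leq_ltn_trans _ (ltn_ord l)).
    by ring.
  by rewrite subr0.
- by move=> i; case: eqP => // _; rewrite mulr_ge0// divr_ge0// ltW.
- move=> i; case: eqP => // _; last exact: ltW.
  by rewrite ler_pM2l ?divr_gt0// ler_nat.
- move=> i; case: eqP => // _.
  by rewrite mulrAC ler_pdivrMr// ler_pM2l// ler_nat.
Qed.

Lemma coincident_strip l n : coincident l `<=`
  \big[setU/set0]_(j < n.+1) crowded (strip l n j).
Proof.
move=> x [p [q [px qx pl ql [pq npq]]]].
have [j jn pj] : exists2 j, (j < n.+1)%N &
    b / n.+1%:R * j%:R <= tnth (\val p).1.1 l <= b / n.+1%:R * j.+1%:R.
  by apply: grid_cover; rewrite divfK ?pnatr_eq0//; exact: centre_cube.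
rewrite -(bigcup_mkord n.+1 (fun j => crowded (strip l n j))); exists j => //=.
have strip_j (r : facets (d:=d) b) : orient r l -> tnth (\val r).1.1 l = tnth (\val p).1.1 l ->
    \val r \in strip l n j.
  move=> /eqP rl rp; apply/mem_set; split=> //; split; last first.
    by have [[]] := set_valP r.
  by move=> i /=; case: eqP => [->|_]; [rewrite rp|exact: centre_cube].
rewrite /crowded /= /count_in.
apply: (@leq_trans #|` [fset p; q]%fset|); first by rewrite cardfs2 npq.
have strip_x r : r \in x -> \val r \in strip l n j ->
    r \in [fset r in (x : {fset facets b}) | \val r \in strip l n j]%fset.
  by move=> rx rs; apply/imfsetP; exists r => //=; apply/andP.
apply/fsubset_leq_card/fsubsetP => r; rewrite in_fset2 => /orP[]/eqP ->.
  by apply: strip_x => //; exact: strip_j.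
by apply: strip_x => //; apply: strip_j.
Qed.

(** Each of the [n + 1] strips has intensity [A / (n + 1)], so that some strip is
    crowded with probability at most [A ^ 2 / (n + 1)], for every [n]. *)
Lemma coincident_negligible l : P.-negligible (coincident l).
Proof.
pose E n j := crowded (strip l n j).
pose A := a * (b ^+ d / d%:R).
have A0 : 0 < A.
  by rewrite mulr_gt0// divr_gt0 ?exprn_gt0// ltr0n (leq_ltn_trans _ (ltn_ord l)).
have mE n j : (j < n.+1)%N -> measurable (E n j).
  by move=> jn; apply: measurable_crowded; apply: borel_strip.
have mU n : measurable (\big[setU/set0]_(j < n.+1) E n j).
  by apply: bigsetU_measurable => j _; exact: mE.
have PU n : (P (\big[setU/set0]_(j < n.+1) E n j) <= (A ^+ 2 / n.+1%:R)%:E)%E.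
  apply: (le_trans (Boole_inequality _ _)); first by move=> j; exact: mE.
  apply: (@le_trans _ _ (\sum_(j < n.+1) ((A / n.+1%:R) ^+ 2)%:E)%E).
    apply: lee_sum => j _.
    rewrite /A -mulrA; apply: poisson_crowded.
    - exact: borel_strip.
    - exact: lambda_strip.
    - by rewrite mulrA divr_gt0.
  rewrite sumEFin lee_fin sumr_const card_ord -[(A / _) ^+ 2 *+ _]mulr_natr.
  set c : R := n.+1%:R; have c0 : c != 0 by rewrite pnatr_eq0.
  by rewrite (_ : _ ^+ 2 * c = A ^+ 2 / c)//; field; rewrite addrC natr1 pnatr_eq0.
exists (\bigcap_n (\big[setU/set0]_(j < n.+1) E n j)); split.
- exact: bigcapT_measurable.
- apply/eqP; rewrite eq_le measure_ge0 andbT.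
  apply/lee_addgt0Pr => e e0; rewrite add0e.
  pose n := Num.truncn (A ^+ 2 / e).
  apply: (@le_trans _ _ (P (\big[setU/set0]_(j < n.+1) E n j))).
    apply: le_measure; rewrite ?inE//; first exact: bigcapT_measurable.
    exact: bigcap_inf.
  apply: (le_trans (PU n)); rewrite lee_fin ler_pdivrMr// mulrC -ler_pdivrMr//.
  by apply: ltW; exact: truncnS_gt.
- by move=> x xl n _; exact: coincident_strip.
Qed.

Lemma general_position_ae :
  P.-negligible [set x : config d b | ~ general_position x].
Proof.
have : P.-negligible (\big[setU/set0]_(l < d) coincident l).
  elim/big_ind : _ => [|U V|l _]; [exact: negligible_set0| |].
    exact: negligibleU.
  exact: coincident_negligible.
apply: negligibleS => x ngp.
apply: contrapT => nx; apply: ngp => p q l px qx pl ql pq.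
apply: contrapT => /eqP npq; apply: nx; rewrite (bigD1 l) //=; left.
by exists p, q.
Qed.

(** The counts of the different orientations are independent Poisson variables
    of mean [A], being counts in disjoint sets of mass [b ^ d / d] under
    [lambda]. *)
Lemma theta_law (k : d.-tuple nat) : (0 < d)%N ->
  let A := a * b ^+ d / d%:R in
  P (@theta R d b @^-1` [set k]) =
  (A ^+ (\sum_(i < d) tnth k i)%N / (\prod_(i < d) (tnth k i)`!)%N%:R *
   expR (- A) ^+ d)%:E.
Proof.
move=> d0 A; pose B (l : 'I_d) := oriented_box b (fun=> 0) (fun=> b) l.
have mB l : borel_facets b (B l) by exact: borel_oriented_box.
have lB l : lambda b (B l) = (b ^+ d / d%:R)%:E.
  rewrite lambda_oriented_box//; last by move=> _; exact: ltW.
  by rewrite subr0 prodr_const card_ord mulrC.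
rewrite (_ : _ @^-1` _ =
    [set x : config d b | forall i, count_in (B i) x = tnth k i]); last first.
  apply/seteqP; split => [x <- i /=|x xP]; first exact: count_in_orientation.
  by apply: eq_from_tnth => i; rewrite -(xP i) count_in_orientation.
rewrite Ppoi.2//; last first.
  move=> i j _ _ [[[z r] v] [[_ /= vi] [_ vj]]].
  by apply: (@basis_vec_inj R); rewrite -vi.
under eq_bigr => i _.
  rewrite (poisson_count_in (B i) (b ^+ d / d%:R))// ?mulrA; first over.
  by rewrite -mulrA mulr_gt0// divr_gt0 ?exprn_gt0// ltr0n.
rewrite -/A prodEFin; congr EFin.
by rewrite !big_split/= prodrXr prodfV natr_prod prodr_const card_ord.
Qed.

End poisson_facets.

(** * The law of the orientation counts under the submodel *)

Lemma measure_setD_null {dd} {T : measurableType dd} {R : realType}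
    {mu : {measure set T -> \bar R}} {F N : set T} :
  measurable F -> measurable N -> mu N = 0%E -> mu (F `\` N) = mu F.
Proof.
move=> mF mN N0; rewrite -[RHS](measureU0 mF mN N0).
by rewrite -(measureU0 (measurableD mF mN) mN N0) setUDl setDv setD0.
Qed.

Lemma gibbs_general_position {R : realType} {d : nat} {b : R} (nu : R)
    (x : config d b) : general_position x ->
  gibbs_weight nu x = (expR (nu * (\prod_(i < d) tnth (theta x) i)%N%:R))%:E.
Proof. by move=> gp; rewrite /gibbs_weight G_d_general_position. Qed.

Theorem proposition1 (R : realType) (d : nat) (b a nu : R)
    (Pmu : probability (config d b) R) :
  (2 <= d)%N -> 0 < b -> 1 <= a -> nu < 0 ->
  submodel_law a nu Pmu ->
  let A : R := a * b ^+ d / d%:R in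
  exists C : R, 0 < C /\
    forall k : d.-tuple nat,
      pushforward Pmu (@theta R d b) [set k] =
      (C * (A ^+ (\sum_(i < d) tnth k i)%N
              / (\prod_(i < d) (tnth k i)`!)%N%:R
              * expR (nu * (\prod_(i < d) tnth k i)%N%:R)))%:E.
Proof.
move=> d2 b0 a1 _ [P Ppoi PQ] A.
have a0 : 0 < a by exact: lt_le_trans a1.
have d0 : (0 < d)%N by exact: ltn_trans d2.
set c := norm_cst nu P in PQ.
have gibbs_ge0 (x : config d b) : (0 <= gibbs_weight nu x)%E by exact: expeR_ge0.
have c_ge0 : 0 <= c.
  by rewrite /c /norm_cst invr_ge0 fine_ge0// integral_ge0.
(* A vanishing constant would make the density, hence the total mass of [Pmu],
   vanish. *)
have c_gt0 : 0 < c.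
  rewrite lt_neqAle c_ge0 andbT eq_sym; apply/eqP => cE.
  have := PQ setT measurableT; rewrite cE probability_setT integral0_eq.
    by move=> /eqP; rewrite onee_eq0.
  by move=> x _; rewrite mul0e.
have [N [mN PN ngpN]] := general_position_ae a0 b0 Ppoi.
have QN : Pmu N = 0%E.
  rewrite PQ// ge0_integral_null_set// => x; exact: mule_ge0.
exists (c * expR (- A) ^+ d); split; first by rewrite mulr_gt0// exprn_gt0// expR_gt0.
move=> k; rewrite /pushforward.
have mF := @measurable_theta R d b k.
rewrite -[LHS](measure_setD_null mF mN QN).
rewrite [LHS]PQ; last exact: measurableD.
transitivity (\int[P]_(x in theta (b:=b) @^-1` [set k] `\` N)
    cst (c * expR (nu * (\prod_(i < d) tnth k i)%N%:R))%:E x)%E.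
  apply: eq_integral => x /set_mem[/= <- xN].
  rewrite gibbs_general_position//.
  by apply: contrapT => ngp; apply: xN; exact: ngpN.
rewrite integral_cst; last exact: measurableD.
rewrite [X in (_ * X)%E](_ : _ = P (theta (b:=b) @^-1` [set k])); last first.
  exact: (measure_setD_null mF mN PN).
rewrite (theta_law a0 b0 Ppoi)// -/A -EFinM.
by congr EFin; ring.
Qed.
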